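(* Let $G$ be a tree with $n'$ non-leaf vertices, and for $k\ge2$ let $p_k=n_k/n'$ be the concentration of degree-$k$ vertices among the non-leaf vertices, where $n_k$ is the number of vertices of degree $k$. For sufficiently large $n'$, if \[ p_4+2p_5+3p_6+\cdots\ >\ \frac13, \] then $G$ is well-burnable. In particular, this holds if for some $k\ge4$ the concentration of vertices of degree at least $k$ among the non-leaf vertices exceeds $\frac{1}{3(k-3)}$.
   Context: Burning process on a graph $G$: in round 1 one vertex is chosen and set on fire; in each subsequent round, first every burning vertex sets all its neighbours on fire, then one new vertex is chosen and set on fire; the process ends when all vertices are on fire. The burning number $b(G)$ is the minimum number of rounds needed. A graph on $n$ vertices is well-burnable if $b(G)\le\lceil\sqrt n\,\rceil$. *)

(* Defs.v *)
From HB Require Import structures.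
From mathcomp Require Import all_boot all_order all_algebra.
From mathcomp Require Import reals.

Set Implicit Arguments.
Unset Strict Implicit.
Unset Printing Implicit Defensive.

Import Order.TTheory GRing.Theory Num.Theory.

Section Graphs.
Variables (T : finType) (e : rel T).

Definition simple_graph : Prop := symmetric e /\ irreflexive e.

(* In a simple graph a uniq e-cycle of size at least 3 is a cycle in the usual
   sense; those of size 2 are edges traversed back and forth. *)
Definition acyclic : Prop := forall c : seq T, ucycle e c -> size c <= 2.

Definition tree : Prop :=
  [/\ simple_graph, 0 < #|T|, (forall x y, connect e x y) & acyclic].

Definition degree (x : T) : nat := #|[set y | e x y]|.

Definition n_deg (k : nat) : nat := #|[set x | degree x == k]|.

Definition n_deg_ge (k : nat) : nat := #|[set x | k <= degree x]|.

Definition leaf (x : T) : bool := degree x == 1.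

Definition n_nonleaf : nat := #|[set x | ~~ leaf x]|.

Definition spread (B : {set T}) : {set T} :=
  B :|: [set y | [exists x in B, e x y]].

(* B is the set of vertices on fire at the end of the previous round. The fire
   spreads first, then x is set on fire. *)
Definition burn_step (B : {set T}) (x : T) : {set T} := x |: spread B.

(* The chosen vertex must be new, i.e. not yet on fire after the spread; the
   choice is immaterial when the spread has already reached every vertex. *)
Definition new_source (B : {set T}) (x : T) : bool :=
  (x \notin spread B) || (spread B == setT).

Fixpoint legal_sources (B : {set T}) (s : seq T) : bool :=
  if s is x :: s' then new_source B x && legal_sources (burn_step B x) s'
  else true.

Definition burned (s : seq T) : {set T} := foldl burn_step set0 s.

Definition burnable_in (m : nat) : bool :=
  [exists s : m.-tuple T, legal_sources set0 s && (burned s == setT)].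

Lemma ex_burning_choices (k : nat) (B : {set T}) :
  k <= #|T| -> #|T| <= #|B| + k ->
  exists s : k.-tuple T, legal_sources B s && (foldl burn_step B s == setT).
Proof.
elim: k B => [|k IHk] B lek leB.
  exists [tuple]; rewrite /= eqEcard subsetT cardsT.
  by rewrite addn0 in leB.
have [x Nx] : exists x, new_source B x && (#|T| <= #|burn_step B x| + k).
  have sBS : B \subset spread B by apply: subsetUl.
  have [/eqP fullS|/set0Pn[x]] := boolP (~: spread B == set0).
    have spT : spread B = setT by rewrite -[LHS]setCK fullS setC0.
    have [x _|T0] := pickP T.
      by exists x; rewrite /new_source /burn_step spT eqxx orbT setUT cardsT leq_addr.
    by move: lek; rewrite eq_card0.
  rewrite inE => xNS; exists x; rewrite /new_source xNS /=.
  rewrite /burn_step cardsU1 xNS add1n addSnnS.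
  by rewrite (leq_trans leB) // leq_add2r subset_leq_card.
case/andP: Nx => Nx /(IHk _ (ltnW lek))[s /andP[ls fs]].
by exists [tuple of x :: s]; rewrite /= Nx ls.
Qed.

Lemma ex_burnable_in : exists m, burnable_in m.
Proof.
exists #|T|; apply/existsP; apply: ex_burning_choices => //.
by rewrite cards0.
Qed.

Definition burning_number : nat := ex_minn ex_burnable_in.

End Graphs.

Local Open Scope ring_scope.

Definition concentration (R : realType) (T : finType) (e : rel T) (k : nat) : R :=
  (n_deg e k)%:R / (n_nonleaf e)%:R.

Definition concentration_ge (R : realType) (T : finType) (e : rel T) (k : nat) : R :=
  (n_deg_ge e k)%:R / (n_nonleaf e)%:R.

Definition well_burnable (R : realType) (T : finType) (e : rel T) : Prop :=
  (burning_number e)%:Z <= Num.ceil (Num.sqrt (#|T|%:R : R)).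

(* Main.v *)
Require Import Defs.
From mathcomp Require Import all_boot all_order all_algebra.
From mathcomp Require Import reals sequences exp.
From mathcomp Require Import zify ring lra.

(** The leaves of a tree can be burned in one extra round, and counting degrees
    shows that the hypothesis gives [n' < 3/4 n]. It thus suffices that a tree with
    [n'] vertices is covered by balls of radii [0, ..., m - 1] as soon as
    [n' <= 3/4 m^2] and [m] is large.

    Give each radius at most [10 d] a price, nondecreasing in the radius. Take a
    longest path of a subtree of height [11 d], from its bottom. For each [j], the
    ball of radius [j/2] centered at height [j/2] covers the path up to height [j];
    what it misses in the side branches is covered by one ball per component. As [j]
    ranges over [1, ..., 20 d], a side branch pays on average for at most one ball of
    each radius per path of its longest-path decomposition, hence some [j] covers and
    removes a piece whose weight is at least [7.8 d / (average price)] times its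
    total price. Iterating, with prices exponential in the number of times that each
    range of radii was used, uses all ranges of radii almost equally often. *)

Set Implicit Arguments.
Unset Strict Implicit.
Unset Printing Implicit Defensive.

Import Order.TTheory GRing.Theory Num.Theory.

(** * Balls and burning sequences *)

Section Balls.
Variables (V : finType) (e : rel V).
Implicit Types (A B C : {set V}) (u v w x y : V) (s : seq V).

Lemma sub_spread B : B \subset spread e B.
Proof. exact: subsetUl. Qed.

Lemma edge_spread B x y : x \in B -> e x y -> y \in spread e B.
Proof.
by move=> xB exy; rewrite !inE; apply/orP; right; apply/existsP; exists x; rewrite xB.
Qed.

Lemma spreadS B C : B \subset C -> spread e B \subset spread e C.
Proof.
move=> sBC; apply/subsetP => y; rewrite inE => /orP[yB|].
  by rewrite (subsetP (sub_spread C)) ?(subsetP sBC).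
by rewrite inE => /existsP[x /andP[/(subsetP sBC) xC]]; apply: edge_spread.
Qed.

Lemma sub_iter_spread k B : B \subset iter k (spread e) B.
Proof. by elim: k => //= k IHk; apply: subset_trans (sub_spread _). Qed.

Lemma iter_spreadS k B C :
  B \subset C -> iter k (spread e) B \subset iter k (spread e) C.
Proof. by move=> sBC; elim: k => //= k; apply: spreadS. Qed.

Definition ball v k : {set V} := iter k (spread e) [set v].

Lemma ball_center v k : v \in ball v k.
Proof. by rewrite (subsetP (sub_iter_spread _ _)) ?set11. Qed.

Lemma ball_trans u v w a b : u \in ball v a -> w \in ball u b -> w \in ball v (a + b).
Proof.
move=> uv; rewrite /ball addnC iterD; apply/subsetP/iter_spreadS.
by rewrite sub1set.
Qed.

Lemma ball_leq v a b x : a <= b -> x \in ball v a -> x \in ball v b.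
Proof. by move=> /subnKC <- xv; apply: ball_trans xv (ball_center _ _). Qed.

Lemma ball_edge v k x y : x \in ball v k -> e x y -> y \in ball v k.+1.
Proof. exact: edge_spread. Qed.

Lemma ballS_inv v k y :
  y \in ball v k.+1 -> y \in ball v k \/ exists2 x, x \in ball v k & e x y.
Proof.
rewrite [ball v k.+1]iterS !inE => /orP[|/existsP[x /andP[xv exy]]]; first by left.
by right; exists x.
Qed.

Lemma iter_spread_sub_burned B s :
  iter (size s) (spread e) B \subset foldl (burn_step e) B s.
Proof.
elim: s B => //= x s IHs B; apply: subset_trans (IHs _).
by rewrite -iterS iterSr iter_spreadS // subsetUr.
Qed.

Lemma ball_sub_burned B s x0 i : i < size s ->
  ball (nth x0 s i) (size s - i.+1) \subset foldl (burn_step e) B s.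
Proof.
move=> lt_is; rewrite -[s in foldl _ _ s](cat_take_drop i) (drop_nth x0 lt_is).
rewrite foldl_cat /= -size_drop; apply: subset_trans (iter_spread_sub_burned _ _).
by apply: iter_spreadS; rewrite sub1set setU11.
Qed.

Lemma dominating_source B C x : B \subset C ->
  exists2 y, new_source e C y & burn_step e B x \subset burn_step e C y.
Proof.
move=> /spreadS sBC; have [xC|xC] := boolP (x \in spread e C); last first.
  by exists x; rewrite /new_source ?xC // setUS.
have dominates y : burn_step e B x \subset burn_step e C y.
  by rewrite subUset sub1set [burn_step e C y]/burn_step setU1r //= subsetU // sBC orbT.
have [CT|] := eqVneq (spread e C) setT.
  by exists x; rewrite // /new_source CT eqxx orbT.
rewrite -subTset => /subsetPn[y _ yC].
by exists y; rewrite // /new_source yC.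
Qed.

Lemma legal_burning B C s : B \subset C -> foldl (burn_step e) B s = setT ->
  exists s', [/\ size s' = size s, legal_sources e C s'
               & foldl (burn_step e) C s' = setT].
Proof.
elim: s B C => [|x s IHs] B C sBC /= sT.
  by exists [::]; split=> //=; apply/eqP; rewrite -subTset -sT.
have [y Ny /IHs/(_ sT)[s' [zs' ls' s'T]]] := dominating_source x sBC.
by exists (y :: s'); rewrite /= zs' Ny ls'.
Qed.

Definition ball_coverable (A : {pred V}) m : Prop :=
  exists c : nat -> V, forall x, x \in A -> exists2 r, r < m & x \in ball (c r) r.

Lemma ball_coverable_leq (A : {pred V}) m n :
  m <= n -> ball_coverable A m -> ball_coverable A n.
Proof.
by move=> mn [c cP]; exists c => x /cP[r rm xr]; exists r; rewrite // (leq_trans rm).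
Qed.

Lemma burning_number_le m : ball_coverable V m -> burning_number e <= m.
Proof.
case=> c cov; rewrite /burning_number; case: ex_minnP => k _; apply.
pose s := mkseq (fun i => c (m - i.+1)) m.
have sT : foldl (burn_step e) set0 s = setT.
  apply/eqP; rewrite -subTset; apply/subsetP => x _.
  have [|r rm xr] := cov x; first by [].
  have im : m - r.+1 < m by lia.
  have := @ball_sub_burned set0 s (c 0) (m - r.+1); rewrite size_mkseq nth_mkseq //.
  have -> : m - (m - r.+1).+1 = r by lia.
  by move=> /(_ im)/subsetP; apply.
have [s' [zs' ls' s'T]] := legal_burning (subxx set0) sT.
have zs'm : size s' == m by rewrite zs' size_mkseq.
by apply/existsP; exists (Tuple zs'm); rewrite /= ls'; apply/eqP.
Qed.

End Balls.

Arguments ball : simpl never.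

(** * Rooted trees and their longest paths *)

(* A tree rooted at a vertex that is not recorded: [Edge x t] hangs the tree [t]
   rooted at [x] by one edge, [Glue] identifies the roots of two trees. Keeping
   [Glue] binary bounds the growth of the weight from a subterm to a term. *)
Inductive rtree (V : Type) :=
  | Bare
  | Edge of V & rtree V
  | Glue of rtree V & rtree V.

Arguments Bare {V}.

Section LongestPaths.
Variable V : eqType.
Implicit Types (t : rtree V) (v x : V).

Fixpoint height t : nat :=
  match t with
  | Bare => 0
  | Edge _ t1 => (height t1).+1
  | Glue t1 t2 => maxn (height t1) (height t2)
  end.

Fixpoint verts t : seq V :=
  match t with
  | Bare => [::]
  | Edge x t1 => x :: verts t1
  | Glue t1 t2 => verts t1 ++ verts t2
  end.

Definition weight t : nat := size (verts t).

Lemma weight_Edge x t : weight (Edge x t) = (weight t).+1.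
Proof. by []. Qed.

Lemma weight_Glue t1 t2 : weight (Glue t1 t2) = weight t1 + weight t2.
Proof. exact: size_cat. Qed.

Lemma height_le_weight t : height t <= weight t.
Proof. by elim: t => //= t1 IH1 t2 IH2; rewrite weight_Glue; lia. Qed.

Lemma weight_height0 t : height t = 0 -> weight t = 0.
Proof. by elim: t => //= t1 IH1 t2 IH2 h0; rewrite weight_Glue IH1 ?IH2 //; lia. Qed.

Definition taller t1 t2 := if height t2 <= height t1 then t1 else t2.
Definition shorter t1 t2 := if height t2 <= height t1 then t2 else t1.

Lemma height_taller t1 t2 : height (taller t1 t2) = maxn (height t1) (height t2).
Proof. by rewrite /taller; case: leqP. Qed.

Lemma height_shorter t1 t2 : height (shorter t1 t2) <= height (taller t1 t2).
Proof. by rewrite /taller /shorter; case: (leqP (height t2)) => // /ltnW. Qed.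

Lemma perm_taller_shorter t1 t2 :
  perm_eq (verts t1 ++ verts t2) (verts (taller t1 t2) ++ verts (shorter t1 t2)).
Proof. by rewrite /taller /shorter; case: leqP; rewrite // perm_catC. Qed.

Lemma weight_taller_shorter t1 t2 :
  weight (Glue t1 t2) = weight (taller t1 t2) + weight (shorter t1 t2).
Proof. by rewrite /weight (perm_size (perm_taller_shorter _ _)) size_cat. Qed.

Lemma rtree_taller_ind (P : rtree V -> Prop) :
  P Bare -> (forall x t, P t -> P (Edge x t)) ->
  (forall t1 t2, P (taller t1 t2) -> P (Glue t1 t2)) -> forall t, P t.
Proof.
move=> PBare PEdge PGlue; elim=> [|x t /PEdge|t1 P1 t2 P2] //.
by apply: PGlue; rewrite /taller; case: leqP.
Qed.

(* [tip v t h] is the part of [t], rooted at [v], below the point at height [h] of its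
   longest path, together with that point; [prune t h] is the rest of [t]. *)
Fixpoint tip v t h : V * rtree V :=
  if height t <= h then (v, t) else
  match t with
  | Bare => (v, t)
  | Edge x t1 => tip x t1 h
  | Glue t1 t2 => tip v (taller t1 t2) h
  end.

Fixpoint prune t h : rtree V :=
  if height t <= h then Bare else
  match t with
  | Bare => Bare
  | Edge x t1 => Edge x (prune t1 h)
  | Glue t1 t2 => Glue (prune (taller t1 t2) h) (shorter t1 t2)
  end.

Lemma tip_id v t h : height t <= h -> tip v t h = (v, t).
Proof. by case: t => [|x t|t1 t2] //= ->. Qed.

Lemma height_tip v t h : height (tip v t h).2 = minn h (height t).
Proof.
elim/rtree_taller_ind: t v => [|x t IH|t1 t2 IH] v /=; first by rewrite minn0.
  by case: ifP => /= hh; rewrite ?IH; lia.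
by case: ifP => /= hh; rewrite ?IH ?height_taller; lia.
Qed.

Lemma perm_tip_prune v t h :
  perm_eq (verts t) (verts (tip v t h).2 ++ verts (prune t h)).
Proof.
elim/rtree_taller_ind: t v => [|x t IH|t1 t2 IH] v //=; case: ifP => _ /=; rewrite ?cats0 //.
  by rewrite perm_sym perm_catC /= perm_cons perm_catC perm_sym.
by rewrite (perm_trans (perm_taller_shorter t1 t2)) // catA perm_cat2r.
Qed.

Lemma weight_tip_prune v t h : weight t = weight (tip v t h).2 + weight (prune t h).
Proof. by rewrite /weight (perm_size (perm_tip_prune v t h)) size_cat. Qed.

End LongestPaths.

Section Covers.
Variables (V : finType) (e : rel V).
Hypothesis e_sym : symmetric e.
Implicit Types (t : rtree V) (v x : V).

Fixpoint rooted v t : bool :=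
  match t with
  | Bare => true
  | Edge x t1 => e v x && rooted x t1
  | Glue t1 t2 => rooted v t1 && rooted v t2
  end.

Lemma rooted_taller_shorter v t1 t2 :
  rooted v t1 && rooted v t2 = rooted v (taller t1 t2) && rooted v (shorter t1 t2).
Proof. by rewrite /taller /shorter; case: leqP => _; rewrite // andbC. Qed.

Lemma rooted_tip v t h : rooted v t -> rooted (tip v t h).1 (tip v t h).2.
Proof.
elim/rtree_taller_ind: t v => [|x t IH|t1 t2 IH] v //=; case: ifP => //= _.
  by case/andP=> _ /IH.
by rewrite rooted_taller_shorter => /andP[/IH].
Qed.

Lemma rooted_prune v t h : rooted v t -> rooted v (prune t h).
Proof.
elim/rtree_taller_ind: t v => [|x t IH|t1 t2 IH] v //=; case: ifP => //= _.
  by case/andP=> -> /IH.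
by rewrite rooted_taller_shorter => /andP[/IH-> ->].
Qed.

Lemma rooted_ball v t x :
  rooted v t -> x \in v :: verts t -> x \in ball e v (height t).
Proof.
elim: t v => [|y t IH|t1 IH1 t2 IH2] v /=.
- by move=> _; rewrite !inE => /eqP->.
- case/andP=> evy /IH{}IH; rewrite inE => /predU1P[->|/IH xy]; first exact: ball_center.
  by rewrite -add1n; apply: ball_trans xy; apply: ball_edge evy; apply: ball_center.
- case/andP=> /IH1{}IH1 /IH2{}IH2.
  rewrite inE mem_cat => /predU1P[->|/orP[] xt]; first exact: ball_center.
    by apply: ball_leq (leq_maxl _ _) _; apply: IH1; rewrite inE xt orbT.
  by apply: ball_leq (leq_maxr _ _) _; apply: IH2; rewrite inE xt orbT.
Qed.

Lemma ball_tip v t h : rooted v t -> v \in ball e (tip v t h).1 (height t - h).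
Proof.
elim/rtree_taller_ind: t v => [|y t IH|t1 t2 IH] v.
- by rewrite tip_id ?ball_center.
- move=> /= /andP[evy /IH{}IH]; case: (leqP h (height t)) => ht; last by rewrite ball_center.
  by rewrite subSn // (ball_edge IH) // e_sym.
- move=> /=; case: ifP => _; first by rewrite ball_center.
  by rewrite -height_taller rooted_taller_shorter => /andP[/IH].
Qed.

(* [L] lists centers with labels, and [rho] maps a label to a radius. *)
Definition covered (rho : nat -> nat) (L : seq (V * nat)) x : bool :=
  has (fun p => x \in ball e p.1 (rho p.2)) L.

Lemma covered_cat rho L1 L2 x :
  covered rho (L1 ++ L2) x = covered rho L1 x || covered rho L2 x.
Proof. exact: has_cat. Qed.

Section PathCovers.
(* Balls of nominal radius [r] have actual radius [q + r]; a component of height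
   at most [q] left over next to a ball is thus covered for free. *)
Variable q : nat.

Definition root_ball v t : seq (V * nat) :=
  if height t <= q then [::] else [:: (v, height t)].

(* One ball for each component of the part of [t] at distance more than [b]
   from the root. *)
Fixpoint leftover v t b : seq (V * nat) :=
  match t with
  | Bare => [::]
  | Edge x t1 => if b is b'.+1 then leftover x t1 b' else root_ball v t
  | Glue t1 t2 =>
      if b is _.+1 then leftover v t1 b ++ leftover v t2 b else root_ball v t
  end.

(* The ball of radius [uphalf j] centered at height [j./2] of the longest path reaches
   its bottom and its point at height [j], hence depth [j - i] in a branch at height
   [i]. *)
Fixpoint side v t j : seq (V * nat) :=
  match t with
  | Bare => [::]
  | Edge x t1 => side x t1 j
  | Glue t1 t2 => side v (taller t1 t2) j
                  ++ leftover v (shorter t1 t2) (j - height (taller t1 t2))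
  end.

Definition path_cover v t j : seq (V * nat) :=
  ((tip v t j./2).1, uphalf j) :: side v t j.

Lemma root_ball_cover v t u k x :
  rooted v t -> v \in ball e u k -> x \in verts t ->
  (x \in ball e u (q + k)) || covered (addn q) (root_ball v t) x.
Proof.
move=> vt vu xt; have xv : x \in ball e v (height t).
  by apply: rooted_ball; rewrite // inE xt orbT.
rewrite /root_ball; case: leqP => hq /=.
  by rewrite addnC (ball_trans vu (ball_leq hq xv)).
by rewrite (ball_leq _ xv) ?orbT // leq_addl.
Qed.

Lemma leftover_cover v t b u k x :
  rooted v t -> v \in ball e u k -> x \in verts t ->
  (x \in ball e u (q + (k + b))) || covered (addn q) (leftover v t b) x.
Proof.
elim: t v b k => [|y t IH|t1 IH1 t2 IH2] v [|b] k //; rewrite ?addn0;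
  try exact: root_ball_cover.
- move=> /= /andP[evy ty] vu; rewrite inE => /predU1P[->|xt].
    by rewrite (ball_leq _ (ball_edge vu evy)) //; lia.
  by rewrite -addSnnS; apply: IH xt; rewrite // (ball_edge vu evy).
- move=> /= /andP[vt1 vt2] vu; rewrite mem_cat covered_cat => /orP[] xt.
    by case/orP: (IH1 _ b.+1 _ vt1 vu xt) => ->; rewrite ?orbT.
  by case/orP: (IH2 _ b.+1 _ vt2 vu xt) => ->; rewrite ?orbT.
Qed.

Lemma path_cover_covered v t j x :
  rooted v t -> height t <= j -> x \in v :: verts t ->
  covered (addn q) (path_cover v t j) x.
Proof.
have short v' t' : rooted v' t' -> height t' <= j./2 -> x \in v' :: verts t' ->
    covered (addn q) (path_cover v' t' j) x.
  move=> vt ht /(rooted_ball vt) xv.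
  by rewrite /= tip_id // (ball_leq _ xv) //; lia.
have root_covered v' t' : rooted v' t' -> height t' <= j ->
    covered (addn q) (path_cover v' t' j) v'.
  by move=> /(ball_tip j./2) vc tj; rewrite /= (ball_leq _ vc) //; lia.
elim/rtree_taller_ind: t v => [|y t IH|t1 t2 IH] v vt tj xt; first exact: short.
- have [/short->//|hj] := leqP (height (Edge y t)) j./2.
  move: xt; rewrite inE => /predU1P[->|xt]; first exact: root_covered.
  case/andP: vt => _ /IH-/(_ (ltnW tj) xt).
  by rewrite /path_cover /= leqNgt hj.
- have [/short->//|hj] := leqP (height (Glue t1 t2)) j./2.
  move: xt; rewrite inE => /predU1P[->|]; first exact: root_covered.
  move: vt tj hj; rewrite /= rooted_taller_shorter -height_taller => /andP[vt vs] tj hj.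
  rewrite leqNgt hj (perm_mem (perm_taller_shorter _ _)) mem_cat covered_cat => /orP[] xt.
    have := IH v vt tj (mem_behead (s := v :: _) xt).
    by rewrite orbA /= => ->.
  have := leftover_cover (j - height (taller t1 t2)) vs (ball_tip j./2 vt) xt.
  by case/orP=> [xc|->]; rewrite ?orbT // (ball_leq _ xc) //; lia.
Qed.

Lemma root_ball_size v t : size (root_ball v t) * q <= weight t.
Proof.
rewrite /root_ball; have := height_le_weight t.
by case: (leqP (height t) q) => /= hq; lia.
Qed.

Lemma leftover_size v t b : size (leftover v t b) * q <= weight t.
Proof.
elim: t v b => [|y t IH|t1 IH1 t2 IH2] v [|b] //; try exact: root_ball_size.
  by rewrite (leq_trans (IH _ _)) // weight_Edge.
by rewrite /= size_cat mulnDl weight_Glue leq_add.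
Qed.

Lemma side_size v t j : size (side v t j) * q <= weight t.
Proof.
elim/rtree_taller_ind: t v => [|y t IH|t1 t2 IH] v //.
  by rewrite (leq_trans (IH _)) // weight_Edge.
by rewrite weight_taller_shorter /= size_cat mulnDl leq_add // leftover_size.
Qed.

Lemma leftover_radius v t b (p : V * nat) : p \in leftover v t b -> p.2 + b <= height t.
Proof.
have root v' t' : p \in root_ball v' t' -> p.2 + 0 <= height t'.
  by rewrite /root_ball; case: ifP => // _; rewrite inE addn0 => /eqP->.
elim: t v b => [|y t IH|t1 IH1 t2 IH2] v [|b] //; try exact: root.
  by move/IH => /=; rewrite addnS.
by rewrite /= mem_cat leq_max => /orP[/IH1->|/IH2->]; rewrite ?orbT.
Qed.

Lemma side_radius v t j (p : V * nat) :
  p \in side v t j -> p.2 <= height t /\ p.2 + j <= 2 * height t.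
Proof.
elim/rtree_taller_ind: t v => [|y t IH|t1 t2 IH] v //.
  by move/IH => /=; lia.
rewrite /= mem_cat -height_taller => /orP[/IH//|/leftover_radius].
by have := height_shorter t1 t2; lia.
Qed.

End PathCovers.

Definition peels v t t' (C : pred V) k : Prop :=
  [/\ rooted v t', weight t = weight t' + k
    & forall x, x \in verts t -> (x \in verts t') || C x].

Lemma peels_Edge v x t t' C k :
  e v x -> peels x t t' C k -> peels v (Edge x t) (Edge x t') C k.
Proof.
move=> evx [xt' wt tC]; split; first by rewrite /= evx.
  by rewrite !weight_Edge wt.
move=> y; rewrite !inE => /predU1P[->|/tC]; first by rewrite eqxx.
by rewrite -orbA => ->; rewrite orbT.
Qed.

Lemma peels_GlueL v t1 t1' t2 C k :
  rooted v t2 -> peels v t1 t1' C k -> peels v (Glue t1 t2) (Glue t1' t2) C k.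
Proof.
move=> vt2 [vt1' wt tC]; split; first by rewrite /= vt1'.
  by rewrite !weight_Glue wt addnAC.
by move=> y; rewrite !mem_cat => /orP[/tC/orP[]|] ->; rewrite ?orbT.
Qed.

Lemma peels_GlueR v t1 t2 t2' C k :
  rooted v t1 -> peels v t2 t2' C k -> peels v (Glue t1 t2) (Glue t1 t2') C k.
Proof.
move=> vt1 [vt2' wt tC]; split; first by rewrite /= vt1.
  by rewrite !weight_Glue wt addnA.
by move=> y; rewrite !mem_cat => /orP[|/tC/orP[]] ->; rewrite ?orbT.
Qed.

Lemma peels_tip q v t h j : rooted v t -> h <= j ->
  peels v t (prune t h)
    (covered (addn q) (path_cover q (tip v t h).1 (tip v t h).2 j))
    (weight (tip v t h).2).
Proof.
move=> vt hj; split; first exact: rooted_prune.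
  by rewrite addnC -weight_tip_prune.
move=> x; rewrite (perm_mem (perm_tip_prune v t h)) mem_cat orbC => /orP[->//|xt].
apply/orP; right; apply: path_cover_covered; first exact: rooted_tip.
  by rewrite height_tip geq_min hj.
by rewrite inE xt orbT.
Qed.

Definition small h w t : bool := (height t < h) && (weight t < w).

Definition moderate h w t : bool :=
  [&& height t <= h, weight t <= 2 * w & ~~ small h w t].

Lemma moderate_subtree h w v t : 0 < h -> 0 < w -> rooted v t -> ~~ small h w t ->
  exists u s, [/\ rooted u s, moderate h w s
    & forall s' C k, peels u s s' C k -> exists t', peels v t t' C k].
Proof.
move=> h0 w0; elim: t v => [|x t IH|t1 IH1 t2 IH2] v; first by rewrite /small h0 w0.
- move=> vt large; have /andP[evx xt] := vt.
  have [mt|not_moderate] := boolP (moderate h w (Edge x t)).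
    by exists v, (Edge x t); split=> // s' C k; exists s'.
  have [|u [s [us ms sP]]] := IH x xt.
    by move: large not_moderate; rewrite /moderate /small weight_Edge /=; lia.
  by exists u, s; split=> // s' C k /sP[t' tt']; exists (Edge x t'); apply: peels_Edge.
- move=> vt large; have /andP[vt1 vt2] := vt.
  have [mt|not_moderate] := boolP (moderate h w (Glue t1 t2)).
    by exists v, (Glue t1 t2); split=> // s' C k; exists s'.
  have [st1|/(IH1 _ vt1)[u [s [us ms sP]]]] := boolP (small h w t1); last first.
    exists u, s; split=> // s' C k /sP[t' tt'].
    by exists (Glue t' t2); apply: peels_GlueL.
  have [|u [s [us ms sP]]] := IH2 v vt2.
    by move: large not_moderate st1; rewrite /moderate /small weight_Glue /=; lia.
  exists u, s; split=> // s' C k /sP[t' tt'].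
  by exists (Glue t1 t'); apply: peels_GlueR.
Qed.

End Covers.


(** * The average cost of a path cover *)

Section AverageCost.
Local Open Scope ring_scope.
Variables (V : finType) (F : realFieldType) (price : nat -> F) (avg : F) (q : nat).
Hypothesis price_ge0 : forall r, 0 <= price r.
Hypothesis price_avg : forall l : nat, \sum_(r < l) price r.+1 <= avg * l%:R.
Implicit Types (t : rtree V) (v x : V) (L : seq (V * nat)).

Definition cost L : F := \sum_(p <- L) price p.2.

Lemma cost_ge0 L : 0 <= cost L.
Proof. exact: sumr_ge0. Qed.

Lemma cost_cat L1 L2 : cost (L1 ++ L2) = cost L1 + cost L2.
Proof. exact: big_cat. Qed.

Lemma avg_ge0 : 0 <= avg.
Proof. by have := price_avg 1; rewrite big_ord1 mulr1; apply: le_trans. Qed.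

Lemma cost_root_ball v t : cost (root_ball q v t) <= price (height t).
Proof.
by rewrite /root_ball; case: ifP => _; rewrite /cost ?big_nil // big_seq1.
Qed.

Lemma cost_root_ball_Glue v t1 t2 :
  cost (root_ball q v (Glue t1 t2)) <= cost (root_ball q v t1) + cost (root_ball q v t2).
Proof.
have c1 := cost_ge0 (root_ball q v t1); have c2 := cost_ge0 (root_ball q v t2).
rewrite {1}/root_ball [height _]/=; case: (leqP (height t1) (height t2)) => _.
  by rewrite -/(root_ball q v t2) lerDr.
by rewrite -/(root_ball q v t1) lerDl.
Qed.

(* Decomposing a tree into longest paths, each path of length [l] contributes at
   most one ball of each radius [1, ..., l] as [b] varies. *)
Lemma leftover_cost_sum v t n :
  \sum_(b < n) cost (leftover q v t b)
    <= \sum_(r < height t) price r.+1 + avg * ((weight t)%:R - (height t)%:R).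
Proof.
have avg0 := avg_ge0.
have wh s : 0 <= (weight s)%:R - (height s)%:R :> F.
  by rewrite subr_ge0 ler_nat height_le_weight.
have rhs_ge0 s : 0 <= \sum_(r < height s) price r.+1
                      + avg * ((weight s)%:R - (height s)%:R).
  by rewrite addr_ge0 ?sumr_ge0 // mulr_ge0.
elim: t v n => [|x t IH|t1 IH1 t2 IH2] v [|n]; rewrite ?[leLHS]big_ord0 //.
- by rewrite big1 // => b _; rewrite /cost big_nil.
- rewrite big_ord_recl /= [in leRHS]big_ord_recr /=.
  have := IH x n; have := cost_root_ball v (Edge x t) => /=.
  rewrite weight_Edge -[(weight t).+1%:R]natr1 -[(height t).+1%:R]natr1; lra.
- have recl s : \sum_(b < n.+1) cost (leftover q v s b) =
      cost (root_ball q v s) + \sum_(b < n) cost (leftover q v s b.+1).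
    by rewrite big_ord_recl; case: s.
  have := IH1 v n.+1; have := IH2 v n.+1; rewrite !recl.
  under [X in _ -> _ -> _ + X <= _]eq_bigr => b _ do rewrite /= cost_cat.
  rewrite big_split /= weight_Glue natrD.
  have := cost_root_ball_Glue v t1 t2.
  have := price_avg (height t1); have := price_avg (height t2).
  by case: (leqP (height t1) (height t2)) => _; lra.
Qed.

Lemma leftover_cost_le v t n :
  \sum_(b < n) cost (leftover q v t b) <= avg * (weight t)%:R.
Proof. by apply: le_trans (leftover_cost_sum v t n) _; have := price_avg (height t); lra. Qed.

Lemma branch_cost_le v t h (P : pred nat) n : (forall j, P j -> h <= j)%N ->
  \sum_(0 <= j < n | P j) cost (leftover q v t (j - h)) <= avg * (weight t)%:R.
Proof.
move=> hP; apply: le_trans (leftover_cost_le v t (n - h)).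
have -> : \sum_(b < n - h) cost (leftover q v t b) =
    \sum_(0 <= j < n | (h <= j)%N) cost (leftover q v t (j - h)).
  rewrite -(@big_nat_widenl _ _ _ h 0 n xpredT) // -[X in index_iota X]add0n.
  rewrite big_addn big_mkord.
  by apply: eq_bigr => b _; rewrite addnK.
rewrite big_mkcond [leRHS]big_mkcond; apply: ler_sum => j _.
by case: ifP => [/hP->//|_]; case: ifP => // _; apply: cost_ge0.
Qed.

Lemma side_cost_sum (c : nat -> nat) v t n : (forall j, c j <= j)%N ->
  \sum_(0 <= j < n) cost (side q (tip v t (c j)).1 (tip v t (c j)).2 j)
    <= avg * ((weight t)%:R - (height t)%:R).
Proof.
move=> cj; elim/rtree_taller_ind: t v => [|x t IH|t1 t2 IH] v.
- by rewrite subrr mulr0 big1 // => j _; rewrite tip_id // /cost big_nil.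
- have -> : (weight (Edge x t))%:R - (height (Edge x t))%:R
             = (weight t)%:R - (height t)%:R :> F by rewrite weight_Edge /= -!natr1; lra.
  apply: le_trans (IH x); apply: ler_sum => j _ /=.
  by case: ifP => //= htj; rewrite (tip_id x (ltnW htj)).
- have := @branch_cost_le v (shorter t1 t2) (height (taller t1 t2))
    (fun j => height (taller t1 t2) <= c j)%N n (fun j hj => leq_trans hj (cj j)).
  have := IH v; set tall := taller t1 t2 => tall_sum branch_sum.
  have split_cost j : cost (side q (tip v (Glue t1 t2) (c j)).1 (tip v (Glue t1 t2) (c j)).2 j)
      = cost (side q (tip v tall (c j)).1 (tip v tall (c j)).2 j)
        + if (height tall <= c j)%N
          then cost (leftover q v (shorter t1 t2) (j - height tall)) else 0.
    rewrite /= -height_taller -/tall; case: ifP => htj; last by rewrite addr0.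
    by rewrite /= -/tall cost_cat (tip_id _ htj).
  rewrite (eq_bigr _ (fun j _ => split_cost j)) big_split /= -big_mkcond.
  by rewrite weight_taller_shorter natrD -height_taller; lra.
Qed.

Lemma uphalf_sum n :
  \sum_(1 <= j < (2 * n).+1) price (uphalf j) = 2 * \sum_(r < n) price r.+1.
Proof.
elim: n => [|n IH]; first by rewrite big_geq // big_ord0 mulr0.
rewrite mulnS !addSn add0n big_nat_recr // big_nat_recr // IH big_ord_recr mulrDr /=.
have -> : uphalf (2 * n) = n by lia.
have -> : (2 * n)./2 = n by lia.
ring.
Qed.

Lemma path_cover_cost_sum (c : nat -> nat) v t n : (forall j, c j <= j)%N ->
  \sum_(1 <= j < (2 * n).+1) cost (path_cover q (tip v t (c j)).1 (tip v t (c j)).2 j)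
    <= avg * ((2 * n)%:R + (weight t)%:R - (height t)%:R).
Proof.
move=> cj; have := side_cost_sum v t (2 * n).+1 cj.
rewrite big_ltn // => /(le_trans (ler_wpDl (cost_ge0 _) (lexx _))) sides.
under eq_bigr => j _ do rewrite /cost big_cons.
by rewrite big_split uphalf_sum natrM; have := price_avg n; move: sides; rewrite /cost /=; lra.
Qed.

End AverageCost.

(** * Peeling off a tip at a low price *)

Section TipGain.
Variables (V : eqType) (m d : nat).
Implicit Types (t : rtree V) (v : V).

(* Branches above height [m] are included only when the ball reaches [2 * d] higher,
   so that no leftover component of a tree of height [m + d] is higher than [m]. *)
Definition tip_height j : nat :=
  if j <= m then j else if j <= m + 2 * d then m else m + d.

Variant tip_height_spec j : nat -> Type :=
  | TipLow of j <= m : tip_height_spec j j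
  | TipMiddle of m < j <= m + 2 * d : tip_height_spec j m
  | TipHigh of m + 2 * d < j : tip_height_spec j (m + d).

Lemma tip_heightP j : tip_height_spec j (tip_height j).
Proof.
by rewrite /tip_height; case: ifP => jm; [|case: ifP => jmd]; constructor; lia.
Qed.

Lemma tip_height_le j : tip_height j <= j.
Proof. by case: tip_heightP; lia. Qed.

Lemma weight_tip_ge v t h : minn h (height t) <= weight (tip v t h).2.
Proof. by rewrite -(height_tip v) height_le_weight. Qed.

Hypothesis d_small : 2 * d <= m.

Lemma high_tips_weight v t : height t <= m + d ->
  \sum_((m + 2 * d).+1 <= j < (2 * m).+1) weight (tip v t (tip_height j)).2
    = (m - 2 * d) * weight t.
Proof.
move=> tmd; rewrite (eq_big_nat _ _ (F2 := fun=> weight t)) => [|j /andP[jm _]].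
  by rewrite sum_nat_const_nat; congr (_ * _); lia.
by case: tip_heightP; [lia|lia|rewrite tip_id].
Qed.

Lemma middle_tips_weight v t : m <= height t ->
  2 * d * m <= \sum_(m.+1 <= j < (m + 2 * d).+1) weight (tip v t (tip_height j)).2.
Proof.
move=> mt; have -> : 2 * d * m = \sum_(m.+1 <= j < (m + 2 * d).+1) m.
  by rewrite sum_nat_const_nat subSS addKn.
rewrite big_nat [leqRHS]big_nat; apply: leq_sum => j jm.
by apply: leq_trans (weight_tip_ge _ _ _); case: tip_heightP; lia.
Qed.

Lemma low_tips_weight v t : m <= height t ->
  m ^ 2 <= 2 * \sum_(1 <= j < m.+1) weight (tip v t (tip_height j)).2.
Proof.
move=> mt; apply: (@leq_trans (2 * \sum_(1 <= j < m.+1) j)).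
  have := bin2_sum m.+1; rewrite big_ltn // add0n => ->.
  by rewrite -mul_bin_diag bin1 -mulnn leq_mul.
rewrite leq_pmul2l // big_nat [leqRHS]big_nat; apply: leq_sum => j jm.
by apply: leq_trans (weight_tip_ge _ _ _); case: tip_heightP; lia.
Qed.

Lemma tall_tips_weight v t : height t = m + d ->
  m ^ 2 + 4 * d * m + 2 * (m - 2 * d) * weight t
    <= 2 * \sum_(1 <= j < (2 * m).+1) weight (tip v t (tip_height j)).2.
Proof.
move=> tmd; have mt : m <= height t by rewrite tmd leq_addr.
rewrite (@big_cat_nat _ _ _ m.+1) //=; last lia.
rewrite (@big_cat_nat _ _ _ (m + 2 * d).+1 m.+1) //=; try lia.
rewrite high_tips_weight ?tmd // !mulnDr addnA mulnA leq_add2r.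
by rewrite leq_add ?low_tips_weight // -[4]/(2 * 2) -!mulnA leq_mul2l mulnA middle_tips_weight.
Qed.

Lemma heavy_tips_weight v t : height t <= m + d ->
  (m - 2 * d) * weight t
    <= \sum_(1 <= j < (2 * m).+1) weight (tip v t (tip_height j)).2.
Proof.
move=> tmd; rewrite -(high_tips_weight v tmd).
by rewrite [leqRHS](@big_cat_nat _ _ _ (m + 2 * d).+1) ?leq_addl //; lia.
Qed.

End TipGain.

Lemma exists_le_of_sum_le (F : realDomainType) (m n : nat) (f g : nat -> F) : m < n ->
  (\sum_(m <= i < n) f i <= \sum_(m <= i < n) g i)%R ->
  exists2 i, m <= i < n & (f i <= g i)%R.
Proof.
move=> mn le_fg.
have [/hasP[i]|/hasPn none] := boolP (has (fun i => f i <= g i)%R (index_iota m n)).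
  by rewrite mem_index_iota; exists i.
suff : (\sum_(m <= i < n) g i < \sum_(m <= i < n) f i)%R by rewrite ltNge le_fg.
by apply: ltr_sum_nat => // i; rewrite -mem_index_iota => /none; rewrite -ltNge.
Qed.

Section EfficientPeeling.
Local Open Scope ring_scope.
Variables (V : finType) (e : rel V) (F : realFieldType) (price : nat -> F) (avg : F).
Variables (q d : nat).
Hypothesis e_sym : symmetric e.
Hypothesis price_ge0 : forall r, 0 <= price r.
Hypothesis price_avg : forall l : nat, \sum_(r < l) price r.+1 <= avg * l%:R.
Hypothesis d_gt0 : (0 < d)%N.

(* For radii at most [m] and a tree of height [m + d], the total weight of the tips
   is about [(3/2 m^2 + d m - 2 d^2) / (2 m)] times their total cost over [avg] if the
   tree is a path, and [m - 2 d] times if it is heavy. With [m = 10 d] these ratios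
   are [7.9 d] and [8 d]; [39/5 = 7.8] is below both and beats [3/4 * 10 = 7.5]. *)
Definition efficiently_peelable (n : nat) v (t : rtree V) : Prop :=
  exists t' L k, [/\ peels e v t t' (covered e (addn q) L) k, (0 < k)%N,
    forall p, p \in L -> (p.2 <= 10 * d)%N, (size L * q <= n + q)%N
    & 39 * d%:R * cost price L <= 5 * avg * k%:R].

Let cut_height := tip_height (10 * d) d.

Lemma tips_weight v (t : rtree V) :
  moderate (11 * d) (800 * d) t ->
  (39 * d * (20 * d + (weight t - height t))
     <= 5 * \sum_(1 <= j < (2 * (10 * d)).+1) weight (tip v t (cut_height j)).2)%N.
Proof.
have d_small : (2 * d <= 10 * d)%N by lia.
case/and3P=> td _; rewrite /small; have [lt_td|ge_td _] := ltnP (height t) (11 * d).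
  rewrite -leqNgt => heavy; have td' : (height t <= 10 * d + d)%N by lia.
  have := heavy_tips_weight d_small v td'; rewrite -/cut_height.
  by move: (\sum_(_ <= j < _) _)%N => S; nia.
have td' : height t = (10 * d + d)%N by lia.
have := tall_tips_weight d_small v td'; rewrite -/cut_height.
have := height_le_weight t.
by move: (\sum_(_ <= j < _) _)%N => S; nia.
Qed.

Lemma exists_efficient_tip v (t : rtree V) : moderate (11 * d) (800 * d) t ->
  exists2 j, (0 < j <= 20 * d)%N &
    39 * d%:R
        * cost price (path_cover q (tip v t (cut_height j)).1 (tip v t (cut_height j)).2 j)
      <= 5 * avg * (weight (tip v t (cut_height j)).2)%:R.
Proof.
move=> mt; have -> : (20 * d = 2 * (10 * d))%N by lia.
apply: (exists_le_of_sum_le (m := 1) (n := (2 * (10 * d)).+1)); first by lia.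
rewrite -!mulr_sumr -natr_sum.
have := tips_weight v mt; set S := (\sum_(_ <= j < _) _)%N.
rewrite -(ler_nat F) !natrM natrD natrB ?height_le_weight // => gain.
have cost_le := path_cover_cost_sum q price_ge0 price_avg v t (10 * d)
  (tip_height_le (10 * d) d).
have d39_ge0 : 0 <= 39 * d%:R :> F by rewrite mulr_ge0.
apply: le_trans (ler_wpM2l d39_ge0 cost_le) _.
have := ler_wpM2l (avg_ge0 price_ge0 price_avg) gain.
by rewrite !natrM; lra.
Qed.

Lemma efficient_path_cover v (t : rtree V) : rooted e v t ->
  moderate (11 * d) (800 * d) t -> efficiently_peelable (weight t) v t.
Proof.
move=> vt mt; have [j /andP[j0 jd] efficient] := exists_efficient_tip v mt.
have t0 : (0 < height t)%N.
  by have := @weight_height0 _ t; move: mt; rewrite /moderate /small; lia.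
have hj := tip_height_le (10 * d) d j; have wt := weight_tip_prune v t (cut_height j).
exists (prune t (cut_height j)).
exists (path_cover q (tip v t (cut_height j)).1 (tip v t (cut_height j)).2 j).
exists (weight (tip v t (cut_height j)).2); split=> //.
- exact: peels_tip.
- apply: leq_trans (weight_tip_ge _ _ _); rewrite leq_min t0 andbT /cut_height.
  by case: tip_heightP; lia.
- move=> p; rewrite inE => /predU1P[->|/side_radius] /=; first lia.
  rewrite height_tip /cut_height; case/and3P: mt => td _ _.
  by case: tip_heightP; lia.
- by rewrite /= mulSn addnC leq_add2r (leq_trans (side_size _ _ _ _)) // wt leq_addr.
Qed.

Lemma efficient_peeling v (t : rtree V) : rooted e v t ->
  ~~ small (11 * d) (800 * d) t -> efficiently_peelable (1600 * d) v t.
Proof.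
move=> vt /(moderate_subtree _ _ vt)[||u [s [us ms sP]]]; try lia.
have [s' [L [k [/sP[t' tt'] k0 Ld sizeL costL]]]] := efficient_path_cover us ms.
exists t', L, k; split=> //; apply: leq_trans sizeL _; rewrite leq_add2r.
by case/and3P: ms => _ + _; lia.
Qed.

End EfficientPeeling.

(** * Multiplicative weights *)

Lemma prefix_mean_le (F : numDomainType) (f : nat -> F) (l n : nat) : l <= n ->
  (forall i j, (i <= j < n)%N -> f i <= f j)%R ->
  (n%:R * \sum_(i < l) f i <= l%:R * \sum_(i < n) f i)%R.
Proof.
move=> /subnKC; move: (n - l) => k <- f_mono.
rewrite big_split_ord /= natrD mulrDl mulrDr lerD2l mulr_natl -[X in (_ *+ X)%R]card_ord.
rewrite -sumr_const mulr_sumr; apply: ler_sum => j _.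
rewrite mulr_natl -[X in (_ *+ X)%R]card_ord -sumr_const; apply: ler_sum => i _.
by apply: f_mono; have := ltn_ord i; have := ltn_ord j; lia.
Qed.

Lemma sum_divn (F : pzSemiRingType) (f : nat -> F) (n q : nat) :
  (\sum_(i < n * q) f (i %/ q)%N = q%:R * \sum_(b < n) f b)%R.
Proof.
elim: n => [|n IHn]; first by rewrite !big_ord0 mulr0.
rewrite mulSnr big_split_ord big_ord_recr mulrDr IHn /=; congr (_ + _)%R.
rewrite mulr_natl -[X in (_ *+ X)%R]card_ord -sumr_const; apply: eq_bigr => i _.
by rewrite divnMDl ?divn_small ?addn0 // (leq_trans _ (ltn_ord i)).
Qed.

Lemma expR_le1DxM (R : realType) (x : R) : (expR x <= 1 + x * expR x)%R.
Proof.
have := ler_wpM2r (expR_ge0 x) (expR_ge1Dx (- x)).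
by rewrite expRN mulVf ?gt_eqF ?expR_gt0 // mulrDl mul1r mulNr; lra.
Qed.

Section Bins.
Local Open Scope ring_scope.
Variables (V : finType) (e : rel V) (F : realFieldType) (a q : nat).
Hypotheses (a_gt0 : (0 < a)%N) (q_gt0 : (0 < q)%N).
Implicit Types (L : seq (V * nat)) (x : V).

(* Bin [b] stands for the [q] radii [q * b, ..., q * b + q - 1]. *)
Definition bins : nat := (10 * a).+2.

Definition binned L : bool := all (fun p => p.2 < bins)%N L.

Definition uses L (b : nat) : nat := count (fun p => p.2 == b) L.

Lemma cost_uses (f : nat -> F) L :
  binned L -> \sum_(b < bins) (uses L b)%:R * f b = cost f L.
Proof.
rewrite /cost; elim: L => [|p L IHL] /=.
  by rewrite big_nil big1 // => b _; rewrite mul0r.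
case/andP=> pb /IHL; rewrite big_cons => <-.
rewrite (bigD1 (Ordinal pb)) //= [in RHS](bigD1 (Ordinal pb)) //= eqxx natrD.
rewrite mulrDl mul1r -!addrA; congr (_ + (_ + _)); apply: eq_bigr => b bp.
by rewrite [p.2 == b]eq_sym -[(b : nat) == p.2]/(b == Ordinal pb) (negbTE bp).
Qed.

Section BinPrices.
Variable w : nat -> F.
Hypothesis w_ge0 : forall b, 0 <= w b.

Definition cheapest (r : nat) : nat :=
  [arg min_(b < (ord_max : 'I_bins) | (q + r <= q * b)%N) w b]%O.

Lemma cheapestP r : (r <= 10 * (a * q))%N -> (q + r <= q * cheapest r)%N /\
  forall b, (b < bins)%N -> (q + r <= q * b)%N -> w (cheapest r) <= w b.
Proof.
move=> rd; rewrite /cheapest; case: Order.TotalTheory.arg_minP => [|b rb bmin].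
  by rewrite /= /bins; nia.
by split=> // b' b'B rb'; apply: (bmin (Ordinal b'B)).
Qed.

Definition bin_price (r : nat) : F :=
  if (r <= 10 * (a * q))%N then w (cheapest r) else 0.

Lemma bin_price_ge0 r : 0 <= bin_price r.
Proof. by rewrite /bin_price; case: ifP. Qed.

Lemma bin_price_mono r s : (r <= s <= 10 * (a * q))%N -> bin_price r <= bin_price s.
Proof.
move=> /andP[rs sd]; rewrite /bin_price sd (leq_trans rs sd).
have [_ +] := cheapestP (leq_trans rs sd); apply; first exact: ltn_ord.
by have [+ _] := cheapestP sd; apply: leq_trans; rewrite leq_add2l.
Qed.

Lemma bin_price_total :
  \sum_(r < 10 * (a * q)) bin_price r.+1 <= q%:R * \sum_(b < bins) w b.
Proof.
rewrite mulnA; apply: le_trans (_ : \sum_(r < 10 * a * q) w (r %/ q)%N.+2 <= _).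
  apply: ler_sum => r _; have rd : (r < 10 * (a * q))%N by rewrite mulnA.
  rewrite /bin_price rd; have [_ +] := cheapestP rd; apply.
    by rewrite /bins !ltnS ltn_divLR.
  by have := ltn_ceil r q_gt0; lia.
rewrite (sum_divn (fun b => w b.+2)) ler_wpM2l // /bins !big_ord_recl /= addrA lerDr.
by rewrite addr_ge0.
Qed.

Lemma bin_price_avg l :
  \sum_(r < l) bin_price r.+1 <= (\sum_(b < bins) w b) / (10 * a%:R) * l%:R.
Proof.
set W := \sum_(b < bins) w b; have a0 : 0 < 10 * a%:R :> F by rewrite mulr_gt0 ?ltr0n.
have q0 : 0 < q%:R :> F by rewrite ltr0n.
have total := bin_price_total; rewrite -/W in total.
rewrite mulrAC ler_pdivlMr //.
have [ld|/ltnW dl] := leqP l (10 * (a * q)).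
  have mono i j : (i <= j < 10 * (a * q))%N -> bin_price i.+1 <= bin_price j.+1.
    by move=> ijd; apply: bin_price_mono.
  have := le_trans (prefix_mean_le ld mono) (ler_wpM2l (ler0n _ l) total).
  rewrite !natrM => le_total; rewrite -(ler_pM2l q0); lra.
have -> : \sum_(r < l) bin_price r.+1 = \sum_(r < 10 * (a * q)) bin_price r.+1.
  rewrite -(subnKC dl) big_split_ord /= [X in _ + X]big1 ?addr0 // => r _.
  by rewrite /bin_price ifF //; lia.
have W0 : 0 <= W by apply: sumr_ge0.
have := ler_wpM2r (ltW a0) total; have : W * (10 * (a * q))%:R <= W * l%:R.
  by rewrite ler_wpM2l // ler_nat.
by rewrite !natrM; lra.
Qed.

Definition rebin L : seq (V * nat) := [seq (p.1, cheapest p.2) | p <- L].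

Lemma binned_rebin L : binned (rebin L).
Proof. by apply/allP => p /mapP[p' _ ->]; apply: ltn_ord. Qed.

Lemma cost_rebin L : (forall p, p \in L -> p.2 <= 10 * (a * q))%N ->
  cost w (rebin L) = cost bin_price L.
Proof.
move=> Ld; rewrite /cost big_map !big_seq; apply: eq_bigr => p /Ld pd.
by rewrite /bin_price pd.
Qed.

Lemma covered_rebin L x : (forall p, p \in L -> p.2 <= 10 * (a * q))%N ->
  covered e (addn q) L x -> covered e (muln q) (rebin L) x.
Proof.
move=> Ld /hasP[p pL xp]; rewrite /covered has_map; apply/hasP; exists p => //=.
by have [le_q _] := cheapestP (Ld p pL); apply: ball_leq xp.
Qed.

End BinPrices.
End Bins.

Section BalancedCover.
Local Open Scope ring_scope.
Variables (R : realType) (V : finType) (e : rel V) (a q : nat) (eta : R).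
Hypothesis e_sym : symmetric e.
Hypotheses (a_gt0 : (0 < a)%N) (q_gt0 : (0 < q)%N) (eta_gt0 : 0 < eta).
Implicit Types (U : nat -> nat) (L : seq (V * nat)) (t : rtree V).

Definition bin_weight U (b : nat) : R := expR (eta * (U b)%:R).

Definition potential U : R := \sum_(b < bins a) bin_weight U b.

Lemma bin_weight_ge0 U b : 0 <= bin_weight U b.
Proof. exact: expR_ge0. Qed.

Lemma potential_ge0 U : 0 <= potential U.
Proof. by apply: sumr_ge0 => b _; apply: bin_weight_ge0. Qed.

Lemma bin_weight_le_potential U b : (b < bins a)%N -> bin_weight U b <= potential U.
Proof.
move=> bB; rewrite /potential (bigD1 (Ordinal bB)) //= lerDl sumr_ge0 // => i _.
exact: bin_weight_ge0.
Qed.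

Definition add_uses U L (b : nat) : nat := U b + uses L b.

Lemma potential_add_uses U L (n : nat) : binned a L -> (size L <= n)%N ->
  potential (add_uses U L)
    <= potential U + eta * expR (eta * n%:R) * cost (bin_weight U) L.
Proof.
move=> LB Ln; rewrite -(cost_uses _ LB) mulr_sumr -big_split /=; apply: ler_sum => b _.
rewrite /bin_weight natrD mulrDr expRD; set w := expR (eta * (U b)%:R).
set k := uses L b; have kn : (k <= n)%N by apply: leq_trans Ln; apply: count_size.
have growth : expR (eta * k%:R) <= 1 + eta * k%:R * expR (eta * n%:R).
  apply: le_trans (expR_le1DxM _) _; rewrite lerD2l ler_wpM2l //.
    by rewrite mulr_ge0 // ltW.
  by rewrite ler_expR ler_pM2l // ler_nat.
have := ler_wpM2l (expR_ge0 (eta * (U b)%:R)) growth; rewrite -/w; lra.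
Qed.

Definition max_balls : nat := (1600 * a).+1.

Lemma size_le_max_balls L :
  (size L * q <= 1600 * (a * q) + q)%N -> (size L <= max_balls)%N.
Proof. by rewrite mulnA -mulSnr leq_pmul2r. Qed.

(* Growth rate of the logarithm of the potential per vertex peeled off. *)
Definition growth_rate : R :=
  eta * expR (eta * max_balls%:R) / (78 * a%:R ^+ 2 * q%:R).

Lemma growth_rate_ge0 : 0 <= growth_rate.
Proof. by rewrite divr_ge0 // !mulr_ge0 ?exprn_ge0 ?expR_ge0 // ltW. Qed.

Lemma balanced_peeling U v t : rooted e v t -> ~~ small (11 * (a * q)) (800 * (a * q)) t ->
  exists t' L k, [/\ peels e v t t' (covered e (muln q) L) k, (0 < k)%N, binned a L
    & potential (add_uses U L) <= potential U * expR (growth_rate * k%:R)].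
Proof.
move=> vt large; have d0 : (0 < a * q)%N by rewrite muln_gt0 a_gt0.
have [t' [L [k [[vt' wt tL] k0 Ld sizeL costL]]]] :=
  efficient_peeling q e_sym (bin_price_ge0 a q (bin_weight_ge0 U))
    (bin_price_avg a_gt0 q_gt0 (bin_weight_ge0 U)) d0 vt large.
exists t', (rebin a q (bin_weight U) L), k; split=> //.
- split=> // x /tL/orP[->//|xL]; apply/orP; right; exact: covered_rebin xL.
- exact: binned_rebin.
apply: le_trans (potential_add_uses U (n := max_balls) _ _) _; first exact: binned_rebin.
  by rewrite size_map size_le_max_balls.
have a0 : 0 < a%:R :> R by rewrite ltr0n.
have cost_le : cost (bin_price a q (bin_weight U)) L
    <= potential U * k%:R / (78 * a%:R ^+ 2 * q%:R).
  rewrite ler_pdivlMr ?mulr_gt0 ?exprn_gt0 ?ltr0n //.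
  have -> : potential U * k%:R = 5 * (potential U / (10 * a%:R)) * k%:R * (2 * a%:R).
    by field; rewrite gt_eqF.
  apply: le_trans (ler_wpM2r _ costL); last by rewrite mulr_ge0 // ltW.
  by rewrite natrM; lra.
rewrite cost_rebin //; apply: le_trans (_ : potential U * (1 + growth_rate * k%:R) <= _).
  have := ler_wpM2l (mulr_ge0 (ltW eta_gt0) (expR_ge0 (eta * max_balls%:R))) cost_le.
  by rewrite /growth_rate; lra.
by rewrite ler_wpM2l ?potential_ge0 // expR_ge1Dx.
Qed.

Lemma small_cover v t : rooted e v t -> small (11 * (a * q)) (800 * (a * q)) t ->
  exists L, [/\ binned a L, forall x, x \in v :: verts t -> covered e (muln q) L x
    & (size L <= max_balls)%N].
Proof.
move=> vt /andP[td wt]; pose L := (v, 10 * (a * q))%N :: leftover q v t (10 * (a * q)).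
have Ld p : p \in L -> (p.2 <= 10 * (a * q))%N.
  by rewrite inE => /predU1P[->|/leftover_radius] //=; lia.
exists (rebin a q (fun=> 0 : R) L); split; first exact: binned_rebin.
- move=> x xt; apply: covered_rebin => //; move: xt; rewrite inE => /predU1P[->|xt].
    by rewrite /= ball_center.
  exact: (leftover_cover _ _ vt (ball_center _ _ 0) xt).
- rewrite size_map size_le_max_balls //= mulSn.
  by have := leftover_size q v t (10 * (a * q)); lia.
Qed.

Lemma balanced_cover U v t : rooted e v t ->
  exists L, [/\ binned a L, forall x, x \in v :: verts t -> covered e (muln q) L x
    & forall b, (b < bins a)%N -> bin_weight (add_uses U L) b
        <= potential U * expR (growth_rate * (weight t)%:R + eta * max_balls%:R)].
Proof.
have [n] := ubnP (weight t); elim: n t U => // n IHn t U tn vt.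
have [/(small_cover vt)|/(balanced_peeling U vt)] :=
  boolP (small (11 * (a * q)) (800 * (a * q)) t).
  case=> L [LB tL sizeL]; exists L; split=> // b bB.
  rewrite /bin_weight natrD mulrDr expRD ler_pM ?expR_ge0 ?bin_weight_le_potential //.
  rewrite ler_expR; apply: le_trans (_ : eta * max_balls%:R <= _).
    by rewrite ler_pM2l // ler_nat (leq_trans (count_size _ _)).
  by rewrite lerDr mulr_ge0 ?growth_rate_ge0.
case=> t' [L1 [k [[vt' wt tL1] k0 L1B potentialL1]]].
have t'n : (weight t' < n)%N by lia.
have [L2 [L2B tL2 usesL2]] := IHn t' (add_uses U L1) t'n vt'.
exists (L1 ++ L2); split; first by rewrite /binned all_cat [all _ _]L1B.
- move=> x; rewrite covered_cat inE => /predU1P[->|/tL1/orP[xt|->//]].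
    by rewrite tL2 ?orbT ?mem_head.
  by rewrite tL2 ?orbT // inE xt orbT.
- move=> b bB; have := usesL2 b bB.
  rewrite /bin_weight /add_uses /uses count_cat addnA => /le_trans; apply.
  rewrite wt addnC natrD mulrDr -addrA [expR (_ * k%:R + _)]expRD mulrA.
  by rewrite ler_wpM2r ?expR_ge0.
Qed.

Lemma cover_with_few_uses v t : rooted e v t ->
  exists L, [/\ binned a L, forall x, x \in v :: verts t -> covered e (muln q) L x
    & forall b, (b < bins a)%N -> (uses L b)%:R <= (bins a)%:R / eta
        + expR (eta * max_balls%:R) * ((weight t)%:R / (78 * a%:R ^+ 2 * q%:R))
        + max_balls%:R].
Proof.
move=> /(balanced_cover (fun=> 0%N))[L [LB tL usesL]]; exists L; split=> // b bB.
have initial : potential (fun=> 0%N) = (bins a)%:R.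
  rewrite /potential (eq_bigr (fun=> 1)) ?sumr_const ?card_ord // => i _.
  by rewrite /bin_weight mulr0 expR0.
have bins_le : (bins a)%:R <= expR ((bins a)%:R : R).
  by apply: le_trans (expR_ge1Dx _); rewrite lerDr.
have := usesL b bB; rewrite initial => /le_trans/(_ (ler_wpM2r (expR_ge0 _) bins_le)).
rewrite -expRD ler_expR /add_uses add0n => uses_le; rewrite -(ler_pM2l eta_gt0).
apply: le_trans uses_le _; rewrite le_eqVlt; apply/orP; left; apply/eqP.
by rewrite /growth_rate; field; rewrite !pnatr_eq0 -!lt0n a_gt0 q_gt0 gt_eqF.
Qed.

End BalancedCover.

(** * Covering large trees by balls of distinct radii *)

Lemma ball_coverable_of_few_uses (V : finType) (e : rel V) (A : {pred V}) (a q : nat)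
    (v : V) (L : seq (V * nat)) :
  binned a L -> (forall x, x \in A -> covered e (muln q) L x) ->
  (forall b, b < bins a -> uses L b <= q) -> ball_coverable e A (bins a * q).
Proof.
move=> /allP LB AL few; pose centers b := [seq p.1 | p <- L & p.2 == b].
exists (fun r => nth v (centers (r %/ q)) (r %% q)) => x /AL/hasP[p pL xp].
have p_center : p.1 \in centers p.2 by apply: map_f; rewrite mem_filter eqxx.
have pB := LB _ pL; set i := index p.1 (centers p.2).
have iq : i < q.
  by apply: leq_trans (few _ pB); rewrite /uses -size_filter -(size_map fst) index_mem.
have q0 : 0 < q by apply: leq_ltn_trans iq.
exists (p.2 * q + i).
  by rewrite (leq_trans _ (leq_mul pB (leqnn q))) // mulSn addnC ltn_add2r.
rewrite divnMDl // divn_small // addn0 modnMDl modn_small // nth_index //.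
by apply: ball_leq xp; rewrite mulnC leq_addr.
Qed.

Section LargeTrees.
Local Open Scope ring_scope.
Variable R : realType.

Lemma main_term_le (a q n : nat) :
  (50 <= a)%N -> (0 < q)%N -> (4 * n <= 3 * (bins a * q.+1) ^ 2)%N ->
  n%:R / (78 * a%:R ^+ 2 * q%:R) <= 972 / 1000 * (q%:R + 3) :> R.
Proof.
move=> a50 q0 nq; have a0 : (0 < a)%N by lia.
rewrite ler_pdivrMr ?mulr_gt0 ?exprn_gt0 ?ltr0n //.
have n_le : 4 * n%:R <= 3 * ((bins a)%:R * (q%:R + 1)) ^+ 2 :> R.
  by move: nq; rewrite -(ler_nat R) 2!natrM natrX natrM -[in q.+1]addn1 natrD.
have bins_le : (bins a)%:R ^+ 2 <= 101 * a%:R ^+ 2 :> R.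
  have a50R : 50 <= a%:R :> R by rewrite (ler_nat _ 50).
  by rewrite /bins -addn2 natrD natrM; nra.
have q1 : 1 <= q%:R :> R by rewrite (ler_nat _ 1).
have q_le : 303 * (q%:R + 1) ^+ 2 <= 4 * (972 / 1000 * (q%:R + 3)) * (78 * q%:R) :> R by nra.
have := ler_wpM2r (sqr_ge0 (q%:R + 1)) bins_le.
have := ler_wpM2l (sqr_ge0 a%:R) q_le.
by rewrite exprMn in n_le; lra.
Qed.

(* The bound of [cover_with_few_uses] for [eta = 1 / (100 * max_balls a)], without its
   main term. *)
Definition slack (a : nat) : nat := 100 * max_balls a * bins a + max_balls a.

Lemma ball_coverable_rtree (V : finType) (e : rel V) (a q : nat) v t :
  symmetric e -> (50 <= a)%N -> (100 * (slack a + 3) <= q)%N -> rooted e v t ->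
  (4 * weight t <= 3 * (bins a * q.+1) ^ 2)%N ->
  ball_coverable e [in v :: verts t] (bins a * q).
Proof.
move=> e_sym a50 slack_le vt wt; have a0 : (0 < a)%N by lia.
have q0 : (0 < q)%N by lia.
have max0 : 0 < (max_balls a)%:R :> R by rewrite ltr0n.
pose eta : R := (100 * (max_balls a)%:R)^-1.
have eta0 : 0 < eta by rewrite invr_gt0 mulr_gt0.
have [L [LB tL usesL]] := cover_with_few_uses e_sym a0 q0 eta0 vt.
apply: (ball_coverable_of_few_uses v LB tL) => b /usesL uses_le.
rewrite -(ler_nat R); apply: le_trans uses_le _.
have -> : eta * (max_balls a)%:R = 100^-1 by rewrite /eta; field; rewrite gt_eqF.
have exp_le : expR 100^-1 <= 100 / 99 :> R by have := expR_le1DxM (100^-1 : R); lra.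
have ratio_ge0 : 0 <= (weight t)%:R / (78 * a%:R ^+ 2 * q%:R) :> R.
  by rewrite divr_ge0 // !mulr_ge0 ?exprn_ge0.
have := ler_pM (expR_ge0 _) ratio_ge0 exp_le (main_term_le a50 q0 wt).
move: slack_le; rewrite -(ler_nat R) /slack !natrM !natrD !natrM /eta invrK.
have := ler0n R q; lra.
Qed.

Lemma large_rtree_coverable : exists n : nat, forall (V : finType) (e : rel V) m v t,
  symmetric e -> rooted e v t -> (n <= m)%N -> (4 * weight t <= 3 * m ^ 2)%N ->
  ball_coverable e [in v :: verts t] m.-1.
Proof.
have [a a50] : exists a, (50 <= a)%N by exists 50%N.
exists (bins a * (100 * (slack a + 3))).+1 => V e [|m] v t e_sym vt //.
rewrite ltnS => le_m wt; pose q := (m %/ bins a)%N.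
have mB : (m < bins a * q.+1)%N by rewrite mulnC ltn_ceil.
apply: (@ball_coverable_leq _ _ _ (bins a * q)); first by rewrite mulnC leq_divM.
apply: ball_coverable_rtree vt _ => //; first by rewrite leq_divRL // mulnC.
by rewrite (leq_trans wt) // leq_mul2l leq_sqr.
Qed.

End LargeTrees.

(** * Spanning rooted trees *)

Lemma perm_cons_swap (T : eqType) (x y : T) (s s' : seq T) :
  perm_eq s (y :: s') -> perm_eq (x :: s) (y :: x :: s').
Proof. by move=> /permP ss'; apply/permP => a; rewrite /= ss' /= addnCA. Qed.

Section SpanningTrees.
Variables (V : finType) (e : rel V).
Implicit Types (t : rtree V) (r v x y : V) (A : {set V}).

Definition descends A r (d : V -> nat) : Prop :=
  forall x, x \in A -> x != r -> exists y, [/\ y \in A, e y x & d y < d x].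

Lemma rooted_graft v t x y : rooted e v t -> x \in v :: verts t -> e x y ->
  exists2 t', rooted e v t' & perm_eq (verts t') (y :: verts t).
Proof.
move=> vt xt exy; elim: t v vt xt => [|z t IH|t1 IH1 t2 IH2] v vt.
- by rewrite inE => /eqP xv; exists (Edge y Bare) => //=; rewrite -xv exy.
- rewrite inE => /predU1P[xv|xt].
    by exists (Glue (Edge y Bare) (Edge z t)); rewrite //= -xv exy /= xv.
  move: vt => /= /andP[evz /IH/(_ xt)[t' zt' t'y]].
  by exists (Edge z t'); [rewrite /= evz | apply: perm_cons_swap].
- move: vt => /= /andP[vt1 vt2]; rewrite inE mem_cat orbA => /orP[xt|xt].
    have [t' vt' t'y] := IH1 v vt1 xt.
    exists (Glue t' t2); first by rewrite /= vt'.
    by rewrite /= -cat_cons perm_cat2r.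
  have [t' vt' t'y] := IH2 v vt2 (mem_behead (s := v :: _) xt).
  exists (Glue t1 t'); first by rewrite /= vt1.
  by rewrite /= -cat1s perm_sym perm_catCA perm_cat2l perm_sym.
Qed.

Lemma rooted_grow A r d t :
  descends A r d -> rooted e r t -> ~~ (A \subset r :: verts t) ->
  exists x t', [/\ x \in A, x \notin r :: verts t, rooted e r t'
                 & perm_eq (verts t') (x :: verts t)].
Proof.
move=> dP rt /subsetPn[x0 x0A x0t].
pose uncovered x := (x \in A) && (x \notin r :: verts t).
have x0P : uncovered x0 by rewrite /uncovered x0A.
case: (arg_minnP d x0P) => x /andP[xA xt] x_min.
have [|y [yA eyx dyx]] := dP x xA; first by apply: contraNneq xt => ->; rewrite mem_head.
have yt : y \in r :: verts t.
  by apply: contraLR dyx => yt; rewrite -leqNgt x_min // /uncovered yA.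
by have [t' rt' t'x] := rooted_graft rt yt eyx; exists x, t'.
Qed.

Lemma spanning_rtree A r d : r \in A -> descends A r d ->
  exists t, [/\ rooted e r t, A \subset r :: verts t & weight t < #|A|].
Proof.
move=> rA dP.
have grow t : rooted e r t -> uniq (r :: verts t) -> {subset r :: verts t <= A} ->
    exists s, [/\ rooted e r s, A \subset r :: verts s & weight s < #|A|].
  have [n] := ubnP (#|A| - weight t); elim: n t => // n IHn t tn rt ut tA.
  have wt : weight t < #|A|.
    by rewrite -[(weight t).+1](card_uniqP ut) subset_leq_card //; apply/subsetP.
  have [At|/(rooted_grow dP rt)] := boolP (A \subset r :: verts t); first by exists t.
  case=> x [t' [xA xt rt' t'x]].
  have rt'x := perm_cons_swap r t'x.
  apply: IHn rt' _ _.
  - by have -> : weight t' = (weight t).+1 by [exact: perm_size t'x]; lia.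
  - by rewrite (perm_uniq rt'x) /= xt.
  - by move=> y; rewrite (perm_mem rt'x) inE => /predU1P[->//|/tA].
by apply: (grow Bare) => //= x; rewrite inE => /eqP->.
Qed.

End SpanningTrees.

(** * Leaves and degrees of a tree *)

Section Trees.
Variables (T : finType) (e : rel T).
Hypothesis e_tree : tree e.

Let e_sym : symmetric e. Proof. by case: e_tree => [[]]. Qed.
Let e_irr : irreflexive e. Proof. by case: e_tree => [[]]. Qed.

Lemma tree_descends r : exists d, descends e setT r d.
Proof.
have reach x : exists k, x \in ball e r k.
  have [_ _ /(_ r x)/connectP[p ep ->] _] := e_tree.
  elim/last_ind: p ep => [|p y IHp]; first by exists 0; rewrite ball_center.
  rewrite rcons_path last_rcons => /andP[/IHp[k rk] ey].
  by exists k.+1; apply: ball_edge rk ey.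
exists (fun x => ex_minn (reach x)) => x _ xr.
case: ex_minnP => -[|k] xk k_min; first by move: xk; rewrite inE (negbTE xr).
case/ballS_inv: xk => [/k_min|[y yk eyx]]; first by rewrite ltnn.
by exists y; split=> //; case: ex_minnP => l _ /(_ _ yk).
Qed.

Definition avoiding x : rel T := [rel a b | [&& e a b, a != x & b != x]].

Lemma neighbours_avoiding_uniq x y z :
  e x y -> e x z -> connect (avoiding x) y z -> y = z.
Proof.
move=> exy exz /connectP[p0 /shortenP[p fp up _] zp]; apply: contraTeq isT => yz.
have yx : y != x by apply: contraTneq exy => ->; rewrite e_irr.
have [ep xp] : path e y p /\ x \notin y :: p.
  split; first by apply: sub_path fp => a b /and3P[].
  rewrite inE negb_or eq_sym yx /=.
  elim: p (y) fp {up zp} => //= b p IHp a /andP[/and3P[_ _ bx] /IHp].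
  by rewrite inE negb_or eq_sym bx.
have cycle_xyp : ucycle e (x :: y :: p).
  by rewrite /ucycle /ucycleb /= exy rcons_path ep -zp e_sym exz xp.
have [_ _ _ /(_ _ cycle_xyp)] := e_tree.
by case: p zp {fp up ep xp cycle_xyp} => //= zy; rewrite zy eqxx in yz.
Qed.

Definition nonleaves : {set T} := [set x | ~~ leaf e x].

Section Depth.
Variables (r : T) (d : T -> nat).
Hypothesis dP : descends e setT r d.

Lemma connect_root_avoiding x y :
  d y <= d x -> y != x -> connect (avoiding x) y r.
Proof.
have [n] := ubnP (d y); elim: n y => // n IHn y yn dyx yx.
have [->//|yr] := eqVneq y r.
have [z [_ ezy dzy]] := dP (in_setT y) yr.
have zx : z != x by apply: contraTneq dzy => ->; rewrite -leqNgt.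
apply: connect_trans (connect1 _) (IHn z _ _ zx).
- by rewrite /avoiding /= e_sym ezy yx.
- exact: leq_trans dzy _.
- exact: ltnW (leq_trans dzy dyx).
Qed.

Lemma low_neighbour_uniq x y z :
  e x y -> e x z -> d y <= d x -> d z <= d x -> y = z.
Proof.
move=> exy exz dyx dzx; apply: (neighbours_avoiding_uniq exy exz).
have avoiding_sym : symmetric (avoiding x).
  by move=> a b; rewrite /avoiding /= e_sym; congr (_ && _); rewrite andbC.
have neq a : e x a -> a != x by apply: contraTneq => ->; rewrite e_irr.
apply: connect_trans (connect_root_avoiding dyx (neq _ exy)) _.
by rewrite (sym_connect_sym avoiding_sym) connect_root_avoiding ?neq.
Qed.

Lemma parent_nonleaf x y : ~~ leaf e r -> e y x -> d y < d x -> ~~ leaf e y.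
Proof.
move=> rN eyx dyx; have [->//|yr] := eqVneq y r.
have [z [_ ezy dzy]] := dP (in_setT y) yr.
have zx : z != x by apply: contraTneq (ltn_trans dzy dyx) => ->; rewrite ltnn.
suff: 1 < degree e y by rewrite /leaf; case: (degree e y) => [|[]].
by apply/card_gt1P; exists z, x; rewrite !inE e_sym.
Qed.

Lemma nonleaves_descends : r \in nonleaves -> descends e nonleaves r d.
Proof.
rewrite inE => rN x _ xr; have [y [_ eyx dyx]] := dP (in_setT x) xr.
by exists y; rewrite inE (parent_nonleaf rN eyx dyx).
Qed.

(* Each edge is counted at its end of larger depth. *)
Lemma sum_degree_le : \sum_x degree e x <= 2 * #|T|.
Proof.
pose low x y := e x y && (d y <= d x).
have low_le1 x : \sum_y low x y <= 1.
  rewrite -big_mkcond /= sum1_card leqNgt; apply/card_gt1P => -[y [z []]].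
  rewrite !unfold_in => /andP[exy dyx] /andP[exz dzx].
  by rewrite (low_neighbour_uniq exy exz dyx dzx) eqxx.
have degree_le x : degree e x <= \sum_y low x y + \sum_y low y x.
  rewrite -big_split /= /degree cardsE -sum1_card big_mkcond leq_sum // => y _.
  rewrite /low [e y x]e_sym unfold_in.
  by case: (e x y) => //=; case/orP: (leq_total (d y) (d x)) => -> //; rewrite addn1.
apply: leq_trans (leq_sum _ (fun x _ => degree_le x)) _.
rewrite big_split /= [X in _ + X]exchange_big /= addnn -mul2n leq_pmul2l //.
by rewrite -sum1_card; apply: leq_sum => x _; apply: low_le1.
Qed.

End Depth.

Lemma degree_gt0 x : 1 < #|T| -> 0 < degree e x.
Proof.
move=> T1; have [|[w]] := set_0Vmem (~: [set x]).
  by move/(congr1 (fun A : {set T} => #|A|)); rewrite cardsC1 cards0; lia.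
rewrite !inE eq_sym => xw; have [d /(_ x (in_setT x) xw)[y [_ eyx _]]] := tree_descends w.
by apply/card_gt0P; exists y; rewrite inE e_sym.
Qed.

Definition excess_degree : nat := \sum_x (degree e x - 3).

Lemma few_nonleaves : 1 < #|T| ->
  n_nonleaf e < 3 * excess_degree -> 4 * n_nonleaf e < 3 * #|T|.
Proof.
move=> T1; have [r _] : exists r, r \in T by apply/card_gt0P/ltnW.
have [d /sum_degree_le] := tree_descends r.
have nonleafE : n_nonleaf e = \sum_x ~~ leaf e x.
  by rewrite /n_nonleaf cardsE -sum1_card big_mkcond.
have cardE : #|T| = \sum_x leaf e x + \sum_x ~~ leaf e x.
  by rewrite -sum1_card -big_split; apply: eq_bigr => x _; case: leaf.
have : \sum_x (leaf e x + ~~ leaf e x + ~~ leaf e x + (degree e x - 3)) <= \sum_x degree e x.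
  apply: leq_sum => x _; have := degree_gt0 x T1; rewrite /leaf.
  by case: eqP => /=; lia.
rewrite !big_split /= -/excess_degree nonleafE cardE; lia.
Qed.

Lemma burning_number_le_nonleaves r m : r \in nonleaves ->
  ball_coverable e nonleaves m.-1 -> burning_number e <= m.
Proof.
move=> rN [c cP]; apply: burning_number_le; exists (fun k => c k.-1) => x _.
have [d dP] := tree_descends r.
have [xN|xl] := boolP (x \in nonleaves).
  have [k km xk] := cP x xN; exists k.+1; first by lia.
  exact: ball_leq xk.
have xr : x != r by apply: contraNneq xl => ->.
have [y [_ eyx dyx]] := dP x (in_setT x) xr.
have yN : y \in nonleaves.
  by move: rN; rewrite !inE => rN; apply: (parent_nonleaf dP rN eyx dyx).
by have [k km yk] := cP y yN; exists k.+1; [lia | apply: ball_edge yk eyx].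
Qed.

End Trees.

Lemma burning_number_asymptotic (R : realType) :
  exists n : nat, forall (T : finType) (e : rel T) m,
    tree e -> n <= m -> 0 < n_nonleaf e -> 4 * n_nonleaf e <= 3 * m ^ 2 ->
    burning_number e <= m.
Proof.
have [n nP] := large_rtree_coverable R; exists n => T e m e_tree nm.
move=> /card_gt0P[r rN] nonleaf_le.
have [d /(nonleaves_descends e_tree)/(_ rN) dP] := tree_descends e_tree r.
have e_sym : symmetric e by case: e_tree => [[]].
have [t [rt At wt]] := spanning_rtree rN dP.
have [|c cP] := nP T e m r t e_sym rt nm.
  by apply: leq_trans nonleaf_le; rewrite leq_pmul2l // ltnW.
apply: (burning_number_le_nonleaves e_tree rN).
by exists c => x /(subsetP At); apply: cP.
Qed.

Section Concentrations.
Local Open Scope ring_scope.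
Variables (R : realType) (T : finType) (e : rel T).
Hypothesis nonleaf_gt0 : (0 < n_nonleaf e)%N.

Lemma sum_n_deg_le_excess n :
  (\sum_(4 <= k < n) (k - 3) * n_deg e k <= excess_degree e)%N.
Proof.
have term k : ((k - 3) * n_deg e k = \sum_(x | degree e x == k) (degree e x - 3))%N.
  rewrite mulnC /n_deg cardsE -sum_nat_const.
  by apply: eq_big => x; rewrite ?unfold_in // => /eqP->.
under eq_bigr => k _ do rewrite term big_mkcond.
rewrite exchange_big /=; apply: leq_sum => x _.
rewrite -big_mkcond /= big_const_seq iter_addn_0 -[leqRHS]muln1 leq_mul2l.
apply/orP; right; rewrite (eq_count (a2 := pred1 (degree e x))) => [|k].
  by rewrite count_uniq_mem ?iota_uniq // leq_b1.
by rewrite /= eq_sym.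
Qed.

Lemma n_deg_ge_le_excess k : ((k - 3) * n_deg_ge e k <= excess_degree e)%N.
Proof.
rewrite mulnC /n_deg_ge cardsE -sum_nat_const big_mkcond; apply: leq_sum => x _.
by rewrite unfold_in; case: ifP => // kx; rewrite leq_sub2r.
Qed.

Lemma concentration_excess n :
  \sum_(4 <= k < n) (k - 3)%:R * concentration R e k > 1 / 3 ->
  (n_nonleaf e < 3 * excess_degree e)%N.
Proof.
have -> : \sum_(4 <= k < n) (k - 3)%:R * concentration R e k =
    (\sum_(4 <= k < n) (k - 3) * n_deg e k)%:R / (n_nonleaf e)%:R.
  rewrite natr_sum mulr_suml; apply: eq_bigr => k _.
  by rewrite /concentration mulrA natrM.
rewrite ltr_pdivlMr ?ltr0n // => big; rewrite -(ltr_nat R) natrM.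
by have := sum_n_deg_le_excess n; rewrite -(ler_nat R); lra.
Qed.

Lemma concentration_ge_excess k : (4 <= k)%N ->
  concentration_ge R e k > 1 / (3 * (k - 3)%:R) ->
  (n_nonleaf e < 3 * excess_degree e)%N.
Proof.
move=> k4; rewrite ltr_pdivlMr ?ltr0n // mul1r mulrC ltr_pdivrMr; last first.
  by rewrite mulr_gt0 // ltr0n subn_gt0.
move=> big; rewrite -(ltr_nat R) natrM.
by have := n_deg_ge_le_excess k; rewrite -(ler_nat R) natrM; lra.
Qed.

End Concentrations.

Local Open Scope ring_scope.

Lemma well_burnable_of_sqr (R : realType) (T : finType) (e : rel T) (m : nat) :
  (burning_number e <= m.+1)%N -> (m ^ 2 < #|T|)%N -> well_burnable R e.
Proof.
move=> bm mT; rewrite /well_burnable.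
suff : m%:Z < Num.ceil (Num.sqrt (#|T|%:R : R)) by lia.
rewrite ceil_gt_int -pmulrn -[ltLHS]ger0_norm // -sqrtr_sqr ltr_sqrt.
  by rewrite -natrX ltr_nat.
by rewrite ltr0n (leq_ltn_trans _ mT).
Qed.

Lemma exists_sqr_lt (n : nat) : (0 < n)%N -> exists m, (m ^ 2 < n <= m.+1 ^ 2)%N.
Proof.
move=> n0; have nn : exists m, (n <= m ^ 2)%N.
  by exists n; rewrite -mulnn leq_pmulr.
case: (ex_minnP nn) => -[|m] mn m_min; first by lia.
by exists m; rewrite mn andbT ltnNge; apply/negP => /m_min; rewrite ltnn.
Qed.

Theorem theorem11 (R : realType) :
  exists N : nat, forall (T : finType) (e : rel T),
    tree e -> (N <= n_nonleaf e)%N ->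
    (\sum_(4 <= k < #|T|) (k - 3)%:R * concentration R e k > 1 / 3 ->
       well_burnable R e) /\
    ((exists k : nat, (4 <= k)%N /\
        concentration_ge R e k > 1 / (3 * (k - 3)%:R)) ->
       well_burnable R e).
Proof.
have [n nP] := burning_number_asymptotic R; exists (n ^ 2 + 2)%N => T e e_tree large.
have nonleaf_gt0 : (0 < n_nonleaf e)%N by lia.
have nonleaf_le : (n_nonleaf e <= #|T|)%N by apply: max_card.
suff main : (n_nonleaf e < 3 * excess_degree e)%N -> well_burnable R e.
  split=> [/(concentration_excess nonleaf_gt0)/main //|[k [k4]]].
  by move=> /(concentration_ge_excess nonleaf_gt0 k4)/main.
move=> /(few_nonleaves e_tree); rewrite (leq_trans _ nonleaf_le); last by lia.
move=> /(_ isT) few; have [|m /andP[mT Tm]] := @exists_sqr_lt #|T|; first by lia.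
apply: well_burnable_of_sqr mT; apply: nP => //; last by lia.
by rewrite -leq_sqr (leq_trans _ Tm) //; lia.
Qed.
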